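(* Let $M=(M_1,\dots,M_n)$, $M_{n+1}=M_1$, be a billiard $n$-gon in an ellipse $\gamma$, and let $\ell_i$ be the tangent line to $\gamma$ at $M_i$. Choose a point $P$ in the plane, and let $Q_i$ be the foot of the perpendicular dropped from $P$ to $\ell_i$. Then the center of mass $\frac1n\sum_{i=1}^n Q_i$ of the points $Q_i$ and the sum $\sum_{i=1}^n|PQ_i|^2$ remain fixed as $M$ varies in the 1-parameter family of $n$-periodic billiard orbits (with $P$ fixed).
   Context: A billiard $n$-gon ($n\ge 3$) in $\gamma$ is a closed $n$-periodic billiard trajectory inside $\gamma$: $M_i\in\gamma$, $M_i\ne M_{i+1}$, and at each $M_i$ the segments $M_{i-1}M_i$ and $M_iM_{i+1}$ obey the law of reflection (equal angles with the tangent line to $\gamma$ at $M_i$). By the Poncelet Porism, periodic billiard orbits in an ellipse come in 1-parameter families: if one billiard trajectory whose sides (extended to lines) are tangent to a given conic confocal with $\gamma$ closes up after $n$ steps, then so does every billiard trajectory tangent to that conic. The 1-parameter family of $n$-periodic billiard orbits consists of all billiard $n$-gons tangent to the same fixed confocal conic. *)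

(* Defs.v *)
From HB Require Import structures.
From mathcomp Require Import all_boot all_order all_algebra.
From mathcomp Require Import all_classical all_reals all_analysis.

Set Implicit Arguments.
Unset Strict Implicit.
Unset Printing Implicit Defensive.

Import Order.TTheory GRing.Theory Num.Theory.
Import numFieldNormedType.Exports.

Local Open Scope classical_set_scope.
Local Open Scope ring_scope.

Notation plane R := 'rV[R]_2.

Definition dotp (R : realType) (u v : plane R) : R := (u *m v^T) 0 0.

(* The library norm on row vectors is the sup norm, hence this definition. *)
Definition enorm (R : realType) (u : plane R) : R := Num.sqrt (dotp u u).

Definition angle (R : realType) (u v : plane R) : R :=
  acos (dotp u v / (enorm u * enorm v)).

Definition rot90 (R : realType) (u : plane R) : plane R :=
  \row_j (if j == 0 then - u 0 1 else u 0 0).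

Definition line (R : realType) (A B : plane R) : set (plane R) :=
  [set X | exists t : R, X = A + t *: (B - A)].

Definition is_foot (R : realType) (P : plane R) (L : set (plane R))
    (Q : plane R) : Prop :=
  L Q /\ forall X, L X -> dotp (P - Q) (X - Q) = 0.

(* An ellipse in arbitrary position; the circle is the case semi_a = semi_b. *)
Record ellipse (R : realType) := Ellipse {
  center : plane R;
  axis : plane R;
  semi_a : R;
  semi_b : R;
  axis_unit : dotp axis axis = 1;
  semi_b_gt0 : 0 < semi_b;
  semi_b_le_a : semi_b <= semi_a
}.

Section Conics.
Variables (R : realType) (g : ellipse R).

Definition xcoord (X : plane R) : R := dotp (X - center g) (axis g).
Definition ycoord (X : plane R) : R := dotp (X - center g) (rot90 (axis g)).

(* Polar form of the quadratic part of the conic confocal with g of parameter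
   lam, namely x^2 / (a^2 - lam) + y^2 / (b^2 - lam) = 1. *)
Definition conic_form (lam : R) (X Y : plane R) : R :=
  xcoord X * xcoord Y / (semi_a g ^+ 2 - lam)
  + ycoord X * ycoord Y / (semi_b g ^+ 2 - lam).

(* The conic is an ellipse if lam < b^2, a hyperbola if b^2 < lam < a^2;
   otherwise it is degenerate or has no real point. *)
Definition confocal_param (lam : R) : Prop :=
  lam < semi_a g ^+ 2 /\ lam <> semi_b g ^+ 2.

Definition confocal_conic (lam : R) : set (plane R) :=
  [set X | conic_form lam X X = 1].

Definition curve : set (plane R) := confocal_conic 0.

Definition tangent_at (lam : R) (T : plane R) : set (plane R) :=
  [set X | conic_form lam T X = 1].

Definition asymptote (lam : R) (L : set (plane R)) : Prop :=
  exists T, [/\ T <> center g, conic_form lam T T = 0 & L = line (center g) T].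

(* The asymptotes of a hyperbola are its tangents at infinity: a trajectory
   with a hyperbolic caustic may have a side on one of them. *)
Definition tangent_to (lam : R) (L : set (plane R)) : Prop :=
  (exists2 T, confocal_conic lam T & L = tangent_at lam T) \/ asymptote lam L.

Definition tangent_line (M : plane R) : set (plane R) := tangent_at 0 M.

(* X - M and M - X point in the two opposite directions of the tangent line. *)
Definition reflection_law (A M B : plane R) : Prop :=
  forall X, tangent_line M X -> X <> M ->
    angle (A - M) (X - M) = angle (B - M) (M - X).

(* ordS and ord_pred are the successor and the predecessor modulo n. *)
Definition billiard_ngon (n : nat) (M : 'I_n -> plane R) : Prop :=
  forall i, [/\ curve (M i), M i <> M (ordS i) &
    reflection_law (M (ord_pred i)) (M i) (M (ordS i))].

Definition billiard_family (n : nat) (lam : R) : set ('I_n -> plane R) :=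
  [set M | billiard_ngon M /\
    forall i, tangent_to lam (line (M i) (M (ordS i)))].

End Conics.

(* Main.v *)
Require Import Defs.
From mathcomp Require Import all_boot all_order all_algebra.
From mathcomp Require Import all_classical all_reals all_analysis.
From mathcomp Require Import ring lra.

Set Implicit Arguments.
Unset Strict Implicit.
Unset Printing Implicit Defensive.

Import Order.TTheory GRing.Theory Num.Theory.
Import numFieldNormedType.Exports.

Local Open Scope classical_set_scope.
Local Open Scope ring_scope.

(** Work in the axes of the ellipse. Let [N] be the gradient
   [(X / a^2, Y / b^2)] at a vertex and let [u], [u'] be the unit directions of
   the sides arriving there and leaving. The reflection law says that
   [u' - u = - 2 J N / |N|^2] with [J = u . N > 0], and tangency to the caustic
   of parameter [lam] forces [J = sqrt lam / (a b)], the same number at every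
   vertex of every polygon of the family (Joachimsthal). The foot of the
   perpendicular from [P] is [P + (1 - P . N) N / |N|^2], so both claims concern
   the sums over the vertices of [N / |N|^2], of the entries of
   [N N^T / |N|^2], and of [1 / |N|^2]. The first is proportional to
   [u' - u] and telescopes. With [u = (cos t, sin t)] and
   [u' = (cos t', sin t')], the entries of the second are affine in
   [cos (t + t')] and [sin (t + t')], and the third is a combination of them
   because [a^2 N_x^2 + b^2 N_y^2 = 1].

   Let [p] be the support number of a side, that is, [p = u x M] for [M] on the
   side, and let [e = J^2 (a^2 - b^2)]. Then
     cos (t' - t) = 1 - J^2 (a^2 + b^2) + e cos (t + t'),
     J (p + p') = - sin (t' - t),    J (p' - p) = - e sin (t + t').
   If [a <> b], the sum of the [sin (t + t')] telescopes by the last relation,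
   and by the first one it remains to show that the sum of the [cos (t' - t)],
   which is [n - J L] for the perimeter [L], is the same for two polygons with
   the same caustic ([orbit_cos_sum]). Instead of deforming one polygon into the
   other through the family, compare them side by side. If [(t, p)] and [(s, q)]
   are corresponding sides, then
     cos (t' - t) - cos (s' - s)
       = J ((p + q) tan ((s - t) / 2) - (p' + q') tan ((s' - t') / 2)),
   which telescopes ([direction_step_cos_diff]). Geometrically, the product
   [(p + q) tan ((s - t) / 2)] is, up to sign, the difference of the positions
   of the intersection point of the two sides along these sides, and the formula
   expresses that the four sides at corresponding vertices touch a common
   circle. The tangents are undefined only where [s = t + pi]. There [q = p] or
   [q = - p], since both sides touch the same conic; as a side determines the
   next one, the second polygon is then the first one reflected in the centre,
   respectively traversed backwards, and the two sums have the same terms.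

   If [a = b], then [p] is constant, the directions advance by a constant angle,
   and the sums of [cos (t + t')] and [sin (t + t')] both telescope to 0. *)

(** * Cyclic index sets *)

Lemma sum_ordS (V : nmodType) (n : nat) (F : 'I_n -> V) :
  \sum_(i < n) F (ordS i) = \sum_(i < n) F i.
Proof. by rewrite [RHS](reindex_inj (@ordS_inj n)). Qed.

Lemma sum_telescope (V : zmodType) (n : nat) (F : 'I_n -> V) :
  \sum_(i < n) (F (ordS i) - F i) = 0.
Proof. by rewrite sumrB sum_ordS subrr. Qed.

Lemma ordS_ind (n : nat) (A : 'I_n -> Prop) (i : 'I_n) :
  A i -> (forall j, A j -> A (ordS j)) -> forall j, A j.
Proof.
case: n A i => [A []//|[|n]] A i Ai AS j; first by rewrite ord1 -(ord1 i).
have step k : A (i + k%:R).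
  elim: k => [|k IHk]; first by rewrite addr0.
  have -> : i + k.+1%:R = ordS (i + k%:R)
    by rewrite mulrSr addrA; exact: (@add_Zp_1 n.+2 (i + k%:R)).
  exact: AS.
by rewrite -(subrKC i j) -(natr_Zp (j - i)).
Qed.

(** The map [j -> 2 i - j] modulo [n], which reverses the cyclic order. *)
Lemma ordS_reflection (n : nat) (i : 'I_n) :
  exists r : 'I_n -> 'I_n,
    [/\ injective r, r i = i & forall j, r (ordS j) = ord_pred (r j)].
Proof.
case: n i => [[]//|[|n]] i; first by exists id; split=> // j; rewrite !ord1.
exists (fun j => i + i - j); split=> [j k /addrI/oppr_inj //||j].
  by rewrite addrK.
have -> : ordS j = j + 1 by rewrite -(@add_Zp_1 n.+2 j).
by rewrite opprD addrA; exact: (@sub_Zp_1 n.+2 (i + i - j)).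
Qed.

(** * The sequence of directions of a billiard orbit *)

(** The unit vector [(x i, y i)] is the direction of the [i]-th side and [p i]
   is its support number, the signed distance from the centre. With
   [(x i, y i) = (cos t, sin t)], the last three clauses are the relations
   between consecutive sides: the first gives [cos (t' - t)] in terms of
   [cos (t + t')], the other two give [p + p'] and [p' - p] in terms of
   [sin (t' - t)] and [sin (t + t')]. *)
Definition direction_orbit (R : realFieldType) (n : nat) (a b J : R)
    (x y p : 'I_n -> R) : Prop :=
  forall i, let j := ordS i in
  [/\ x i ^+ 2 + y i ^+ 2 = 1,
      p i ^+ 2 = b ^+ 2 * x i ^+ 2 + a ^+ 2 * y i ^+ 2
                 - J ^+ 2 * a ^+ 2 * b ^+ 2,
      x i * x j + y i * y j = 1 - J ^+ 2 * (a ^+ 2 + b ^+ 2)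
        + J ^+ 2 * (a ^+ 2 - b ^+ 2) * (x i * x j - y i * y j),
      J * (p i + p j) = - (x i * y j - y i * x j)
    & p j - p i = - (J * (a ^+ 2 - b ^+ 2) * (x i * y j + y i * x j))].

Section DirectionOrbits.
Variables (R : realFieldType) (n : nat) (a b J : R).
Hypotheses (b_gt0 : 0 < b) (b_le_a : b <= a) (J_gt0 : 0 < J).

(** The reflection in the centre keeps support numbers: it reverses directions
   and moves every side to the other side of the centre. *)
Lemma orbit_opp (x y p : 'I_n -> R) :
  direction_orbit a b J x y p ->
  direction_orbit a b J (fun i => - x i) (fun i => - y i) p.
Proof.
move=> O i j; have [h1 h2 h3 h4 h5] := O i; rewrite -/j in h3 h4 h5.
by rewrite !sqrrN !mulrNN.
Qed.

(** Traversing a polygon backwards reverses the orientation of every side, hence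
   also the sign of the support numbers. *)
Lemma orbit_reverse (r : 'I_n -> 'I_n) (x y p : 'I_n -> R) :
  (forall j, r (ordS j) = ord_pred (r j)) ->
  direction_orbit a b J x y p ->
  direction_orbit a b J
    (fun i => - x (r i)) (fun i => - y (r i)) (fun i => - p (r i)).
Proof.
move=> rS O i j; have [h1 h2 _ _ _] := O (r i).
have [_ _ h3 h4 h5] := O (ord_pred (r i)); rewrite /= ord_predK in h3 h4 h5.
rewrite {}/j rS !sqrrN !mulrNN; split => //; lra.
Qed.

(** The two relations are linear in the next direction: they prescribe its
   components along [w = (A x, B y)] and along the vector orthogonal to [w]. If
   [w = 0], then [y = 0] and [A = 0], and the first relation would become
   [0 = A - 2 J^2 b^2]. *)
Lemma direction_step_unique (x y p x1 y1 x2 y2 : R) :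
  let next x' y' :=
    x * x' + y * y' = 1 - J ^+ 2 * (a ^+ 2 + b ^+ 2)
      + J ^+ 2 * (a ^+ 2 - b ^+ 2) * (x * x' - y * y') /\
    2 * J * p = - (x * y' - y * x')
      + J ^+ 2 * (a ^+ 2 - b ^+ 2) * (x * y' + y * x') in
  x ^+ 2 + y ^+ 2 = 1 -> next x1 y1 -> next x2 y2 -> x1 = x2 /\ y1 = y2.
Proof.
move=> next hxy [h1 k1] [h2 k2].
have sq_le : b ^+ 2 <= a ^+ 2.
  by rewrite ler_pXn2r // nnegrE ltW // (lt_le_trans b_gt0).
pose A := 1 - J ^+ 2 * (a ^+ 2 - b ^+ 2).
pose B := 1 + J ^+ 2 * (a ^+ 2 - b ^+ 2).
have J2_gt0 : 0 < J ^+ 2 by rewrite exprn_gt0.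
have b2_gt0 : 0 < b ^+ 2 by rewrite exprn_gt0.
have B_gt0 : 0 < B by rewrite ltr_pwDl // mulr_ge0 ?subr_ge0 // ltW.
have w_neq0 : (A * x) ^+ 2 + (B * y) ^+ 2 != 0.
  apply/eqP => /eqP; rewrite paddr_eq0 ?sqr_ge0 // !sqrf_eq0 => /andP[].
  move=> /eqP Ax0; rewrite mulf_eq0 gt_eqF //= => /eqP y0.
  have xx1 : x ^+ 2 = 1 by move: hxy; rewrite y0 expr0n addr0.
  have A0 : A = 0 by rewrite -[A]mulr1 -xx1 expr2 mulrA Ax0 mul0r.
  have K0 : 1 - J ^+ 2 * (a ^+ 2 + b ^+ 2) = 0.
    have : A * x * x1 + B * y * y1 = 1 - J ^+ 2 * (a ^+ 2 + b ^+ 2).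
      by rewrite /A /B; lra.
    by rewrite Ax0 y0; lra.
  have : 0 < J ^+ 2 * b ^+ 2 by rewrite mulr_gt0.
  by rewrite /A in A0; lra.
have e1 : A * x * (x1 - x2) + B * y * (y1 - y2) = 0 by rewrite /A /B; lra.
have e2 : A * x * (y1 - y2) - B * y * (x1 - x2) = 0 by rewrite /A /B; lra.
suff [/eqP + /eqP] : ((A * x) ^+ 2 + (B * y) ^+ 2) * (x1 - x2) = 0 /\
    ((A * x) ^+ 2 + (B * y) ^+ 2) * (y1 - y2) = 0.
  by rewrite !mulf_eq0 (negPf w_neq0) /= !subr_eq0 => /eqP -> /eqP ->.
split.
  transitivity (A * x * (A * x * (x1 - x2) + B * y * (y1 - y2))
    - B * y * (A * x * (y1 - y2) - B * y * (x1 - x2))); first by ring.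
  by rewrite e1 e2; ring.
transitivity (B * y * (A * x * (x1 - x2) + B * y * (y1 - y2))
  + A * x * (A * x * (y1 - y2) - B * y * (x1 - x2))); first by ring.
by rewrite e1 e2; ring.
Qed.

(** A side, with its support number, determines the whole polygon. *)
Lemma orbit_unique (x y p x' y' p' : 'I_n -> R) (i : 'I_n) :
  direction_orbit a b J x y p -> direction_orbit a b J x' y' p' ->
  x i = x' i -> y i = y' i -> p i = p' i ->
  forall j, [/\ x j = x' j, y j = y' j & p j = p' j].
Proof.
move=> O O' xi yi pi; apply: (@ordS_ind n _ i) => // j [xj yj pj].
have [h1 _ h3 h4 h5] := O j; have [_ _ k3 k4 k5] := O' j.
rewrite -xj -yj -pj in k3 k4 k5.
(* Subtracting the last two relations eliminates the next support number. *)
have next_p q X Y : J * (p j + q) = - (x j * Y - y j * X) ->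
    q - p j = - (J * (a ^+ 2 - b ^+ 2) * (x j * Y + y j * X)) ->
    2 * J * p j = - (x j * Y - y j * X)
      + J ^+ 2 * (a ^+ 2 - b ^+ 2) * (x j * Y + y j * X).
  by move=> e1 /(congr1 ( *%R J)) e2; lra.
have [xS yS] := direction_step_unique h1 (conj h3 (next_p _ _ _ h4 h5))
  (conj k3 (next_p _ _ _ k4 k5)).
by split=> //; move: h5 k5; rewrite xS yS => <- /addIr.
Qed.

(** The tangent of half the angle between two unit vectors, as
   [sin / (1 + cos)]. *)
Definition half_tan (x y x' y' : R) : R :=
  (x * y' - y * x') / (1 + (x * x' + y * y')).

(** The difference of two unit vectors is orthogonal to their sum, and the ratio
   of the lengths is the tangent of the half angle. This makes the difference
   linear in the sum, which is all that the comparison of two orbits uses. *)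
Lemma half_tan_rot (x y x' y' : R) :
  x ^+ 2 + y ^+ 2 = 1 -> x' ^+ 2 + y' ^+ 2 = 1 ->
  1 + (x * x' + y * y') != 0 ->
  x' - x = - (half_tan x y x' y' * (y + y')) /\
  y' - y = half_tan x y x' y' * (x + x').
Proof.
move=> h h' nz; rewrite /half_tan; split; apply: (mulIf nz).
  rewrite mulNr mulrAC divfK //.
  transitivity (- ((x * y' - y * x') * (y + y'))
     + x * (x' ^+ 2 + y' ^+ 2 - 1) - x' * (x ^+ 2 + y ^+ 2 - 1)); first by ring.
  by rewrite h h'; ring.
rewrite mulrAC divfK //.
transitivity ((x * y' - y * x') * (x + x')
     + y * (x' ^+ 2 + y' ^+ 2 - 1) - y' * (x ^+ 2 + y ^+ 2 - 1)); first by ring.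
by rewrite h h'; ring.
Qed.

(** The heart of the proof. Let [m1], [m2] be the sums [(x1, y1) + (z1, w1)] and
   [(x2, y2) + (z2, w2)]. Since the differences are [t1] and [t2] times the
   rotated sums, the difference of the cosines and the sum of the sines of the
   two turning angles are multiples of the cross product of [m1] and [m2]. The
   same holds for the sums of consecutive angles, with [m2] reflected in an
   axis. The relation for the cosines, subtracted for the two orbits, makes
   [t2 - t1] times the one product equal to [J^2 e (t1 + t2)] times the other,
   and then the terms in [t1 t2] cancel. *)
Lemma direction_step_cos_diff (e x1 y1 x2 y2 z1 w1 z2 w2 t1 t2 : R)
    (p1 p2 q1 q2 : R) :
  z1 - x1 = - (t1 * (y1 + w1)) -> w1 - y1 = t1 * (x1 + z1) ->
  z2 - x2 = - (t2 * (y2 + w2)) -> w2 - y2 = t2 * (x2 + z2) ->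
  x1 * x2 + y1 * y2 - (z1 * z2 + w1 * w2) =
    J ^+ 2 * e * (x1 * x2 - y1 * y2 - (z1 * z2 - w1 * w2)) ->
  J * (p1 + p2) = - (x1 * y2 - y1 * x2) ->
  J * (q1 + q2) = - (z1 * w2 - w1 * z2) ->
  p2 - p1 = - (J * e * (x1 * y2 + y1 * x2)) ->
  q2 - q1 = - (J * e * (z1 * w2 + w1 * z2)) ->
  x1 * x2 + y1 * y2 - (z1 * z2 + w1 * w2) =
    J * ((p1 + q1) * t1 - (p2 + q2) * t2).
Proof.
move=> a1 b1 a2 b2 hE hp hq dp dq.
pose m1 := x1 + z1; pose k1 := y1 + w1; pose m2 := x2 + z2; pose k2 := y2 + w2.
have cosE : x1 * x2 + y1 * y2 - (z1 * z2 + w1 * w2) =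
    (t2 - t1) / 2 * (m1 * k2 - k1 * m2).
  transitivity (- ((z1 - x1) * m2 + (w1 - y1) * k2
     + m1 * (z2 - x2) + k1 * (w2 - y2)) / 2).
    by rewrite /m1 /m2 /k1 /k2; field.
  by rewrite a1 b1 a2 b2 -/m1 -/m2 -/k1 -/k2; field.
have cosE' : x1 * x2 - y1 * y2 - (z1 * z2 - w1 * w2) =
    (t1 + t2) / 2 * (m1 * k2 + k1 * m2).
  transitivity (- ((z1 - x1) * m2 - (w1 - y1) * k2
     + m1 * (z2 - x2) - k1 * (w2 - y2)) / 2).
    by rewrite /m1 /m2 /k1 /k2; field.
  by rewrite a1 b1 a2 b2 -/m1 -/m2 -/k1 -/k2; field.
have sinE : x1 * y2 - y1 * x2 + (z1 * w2 - w1 * z2) =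
    (1 + t1 * t2) / 2 * (m1 * k2 - k1 * m2).
  transitivity ((m1 * k2 - k1 * m2 + ((z1 - x1) * (w2 - y2)
     - (w1 - y1) * (z2 - x2))) / 2).
    by rewrite /m1 /m2 /k1 /k2; field.
  by rewrite a1 b1 a2 b2 -/m1 -/m2 -/k1 -/k2; field.
have sinE' : x1 * y2 + y1 * x2 + (z1 * w2 + w1 * z2) =
    (1 - t1 * t2) / 2 * (m1 * k2 + k1 * m2).
  transitivity ((m1 * k2 + k1 * m2 + ((z1 - x1) * (w2 - y2)
     + (w1 - y1) * (z2 - x2))) / 2).
    by rewrite /m1 /m2 /k1 /k2; field.
  by rewrite a1 b1 a2 b2 -/m1 -/m2 -/k1 -/k2; field.
have rhs : 2 * (J * ((p1 + q1) * t1 - (p2 + q2) * t2)) =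
    (t2 - t1) * (x1 * y2 - y1 * x2 + (z1 * w2 - w1 * z2))
    + J ^+ 2 * e * (t1 + t2) * (x1 * y2 + y1 * x2 + (z1 * w2 + w1 * z2)).
  transitivity ((t1 - t2) * (J * (p1 + p2) + J * (q1 + q2))
    - J * (t1 + t2) * (p2 - p1 + (q2 - q1))); first by ring.
  by rewrite hp hq dp dq; ring.
apply: (mulfI (_ : 2 != 0)); first by rewrite pnatr_eq0.
rewrite rhs sinE sinE'.
transitivity ((1 + t1 * t2) * ((t2 - t1) / 2 * (m1 * k2 - k1 * m2))
  + (1 - t1 * t2) * (J ^+ 2 * e * ((t1 + t2) / 2 * (m1 * k2 + k1 * m2))));
  last by field.
by rewrite -cosE' -hE -cosE; ring.
Qed.

(** When no two corresponding sides have opposite directions, the half angles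
   are defined everywhere and the difference of the two sums telescopes. *)
Lemma orbit_cos_sum_no_opposite (x y p x' y' p' : 'I_n -> R) :
  direction_orbit a b J x y p -> direction_orbit a b J x' y' p' ->
  (forall i, 1 + (x i * x' i + y i * y' i) != 0) ->
  \sum_(i < n) (x i * x (ordS i) + y i * y (ordS i)) =
  \sum_(i < n) (x' i * x' (ordS i) + y' i * y' (ordS i)).
Proof.
move=> O O' nz; pose t i := half_tan (x i) (y i) (x' i) (y' i).
pose g i := - (J * ((p i + p' i) * t i)).
apply/eqP; rewrite -subr_eq0 -sumrB -[X in _ == X](sum_telescope g); apply/eqP.
apply: eq_bigr => i _.
have -> : g (ordS i) - g i = J * ((p i + p' i) * t i
    - (p (ordS i) + p' (ordS i)) * t (ordS i)) by rewrite /g; ring.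
have [h1 _ h3 h4 h5] := O i; have [k1 _ k3 k4 k5] := O' i.
have [h1' _ _ _ _] := O (ordS i); have [k1' _ _ _ _] := O' (ordS i).
have [? ?] := half_tan_rot h1 k1 (nz i).
have [? ?] := half_tan_rot h1' k1' (nz (ordS i)).
by apply: (@direction_step_cos_diff (a ^+ 2 - b ^+ 2)) => //; lra.
Qed.

(** Two orbits with the same invariants have the same sum of cosines of turning
   angles, equivalently the same perimeter. If some corresponding sides have
   opposite directions, their support numbers agree up to sign, and the second
   orbit is a symmetric image of the first one. *)
Lemma orbit_cos_sum (x y p x' y' p' : 'I_n -> R) :
  direction_orbit a b J x y p -> direction_orbit a b J x' y' p' ->
  \sum_(i < n) (x i * x (ordS i) + y i * y (ordS i)) =
  \sum_(i < n) (x' i * x' (ordS i) + y' i * y' (ordS i)).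
Proof.
move=> O O'.
have [[i /eqP i0]|nz] :=
    pselect (exists i, 1 + (x i * x' i + y i * y' i) == 0); last first.
  by apply: (orbit_cos_sum_no_opposite O O') => i; apply/negP => i0;
    apply: nz; exists i.
have [h1 h2 _ _ _] := O i; have [k1 k2 _ _ _] := O' i.
have : (x i + x' i) ^+ 2 + (y i + y' i) ^+ 2 = 0 by lra.
move/eqP; rewrite paddr_eq0 ?sqr_ge0 // !sqrf_eq0 !addr_eq0.
move=> /andP[/eqP xi /eqP yi].
have /eqP : p i ^+ 2 = p' i ^+ 2 by rewrite h2 k2 xi yi !sqrrN.
rewrite eqf_sqr => /orP[] /eqP pi.
  have e := orbit_unique O (orbit_opp O') xi yi pi.
  by apply: eq_bigr => j _; have [-> -> _] := e j; have [-> -> _] := e (ordS j);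
    rewrite !mulrNN.
have [r [r_inj ri rS]] := ordS_reflection i.
have OR := orbit_reverse rS O'.
have e : forall j, [/\ x j = - x' (r j), y j = - y' (r j) & p j = - p' (r j)].
  by apply: (orbit_unique (i := i) O OR); rewrite ri.
rewrite [RHS](reindex_inj (inj_comp (@ord_pred_inj n) r_inj)) /=.
apply: eq_bigr => j _; have [-> -> _] := e j; have [-> -> _] := e (ordS j).
by rewrite rS ord_predK; ring.
Qed.

(** The condition [J b < 1] says that the parameter [J^2 a^2 b^2] of the caustic
   is less than [a^2]. In a circle it excludes the polygons that run back and
   forth along a diameter, for which the conclusion fails. *)
Lemma orbit_double_angle_sum (x y p x' y' p' : 'I_n -> R) :
  J * b < 1 ->
  direction_orbit a b J x y p -> direction_orbit a b J x' y' p' ->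
  \sum_(i < n) (x i * x (ordS i) - y i * y (ordS i)) =
  \sum_(i < n) (x' i * x' (ordS i) - y' i * y' (ordS i)) /\
  \sum_(i < n) (x i * y (ordS i) + y i * x (ordS i)) =
  \sum_(i < n) (x' i * y' (ordS i) + y' i * x' (ordS i)).
Proof.
move=> Jb_lt1 O O'; have [ab|ab] := eqVneq (a ^+ 2) (b ^+ 2).
  suff zero (X Y q : 'I_n -> R) : direction_orbit a b J X Y q ->
      \sum_(i < n) (X i * X (ordS i) - Y i * Y (ordS i)) = 0 /\
      \sum_(i < n) (X i * Y (ordS i) + Y i * X (ordS i)) = 0.
    by have [-> ->] := zero _ _ _ O; have [-> ->] := zero _ _ _ O'.
  move=> {x y p x' y' p' O O'} O.
  (* In a circle the support number, hence the turning angle, is constant. *)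
  have qS i : q (ordS i) = q i.
    by have [_ _ _ _] := O i; rewrite ab subrr; lra.
  have q_neq0 i : q i != 0.
    rewrite -sqrf_eq0.
    have [h1 -> _ _ _] := O i; rewrite ab.
    have -> : b ^+ 2 * X i ^+ 2 + b ^+ 2 * Y i ^+ 2 - J ^+ 2 * b ^+ 2 * b ^+ 2
       = b ^+ 2 * (1 - (J * b) ^+ 2) by rewrite -h1; ring.
    rewrite mulf_neq0 ?expf_neq0 ?gt_eqF // subr_gt0 expr_lt1 //.
    by rewrite mulr_ge0 ?ltW.
  pose s i := X i * Y (ordS i) - Y i * X (ordS i).
  have sE i : s i = - (2 * J * q i).
    by have [_ _ _ h4 _] := O i; rewrite qS in h4; rewrite /s; lra.
  have sS i : s (ordS i) = s i by rewrite !sE qS.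
  have s_neq0 i : s i != 0.
    by rewrite sE oppr_eq0 !mulf_neq0 ?q_neq0 ?pnatr_eq0 ?gt_eqF.
  split.
    rewrite -[RHS](sum_telescope (fun i : 'I_n => X i * Y i / s i)).
    apply: eq_bigr => i _; rewrite sS -mulrBl.
    apply: (canRL (mulfK (s_neq0 i))).
    have [h1 _ _ _ _] := O i; have [h1' _ _ _ _] := O (ordS i).
    transitivity (X (ordS i) * Y (ordS i) * (X i ^+ 2 + Y i ^+ 2)
      - X i * Y i * (X (ordS i) ^+ 2 + Y (ordS i) ^+ 2)).
      by rewrite /s; ring.
    by rewrite h1 h1' !mulr1.
  rewrite -[RHS](sum_telescope (fun i : 'I_n => - X i ^+ 2 / s i)).
  apply: eq_bigr => i _; rewrite sS -mulrBl; apply: (canRL (mulfK (s_neq0 i))).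
  have [h1 _ _ _ _] := O i; have [h1' _ _ _ _] := O (ordS i).
  transitivity (X i ^+ 2 * (X (ordS i) ^+ 2 + Y (ordS i) ^+ 2)
    - X (ordS i) ^+ 2 * (X i ^+ 2 + Y i ^+ 2)); first by rewrite /s; ring.
  by rewrite h1 h1' !mulr1 opprK addrC.
have J_neq0 : J != 0 by rewrite gt_eqF.
have e_neq0 : J * (a ^+ 2 - b ^+ 2) != 0 by rewrite mulf_neq0 ?subr_eq0.
have sin0 X Y q : direction_orbit a b J X Y q ->
    \sum_(i < n) (X i * Y (ordS i) + Y i * X (ordS i)) = 0.
  move=> OX; apply: (mulfI e_neq0); rewrite mulr0 -[RHS]oppr0.
  rewrite -[in RHS](sum_telescope q) -sumrN mulr_sumr.
  by apply: eq_bigr => i _; have [_ _ _ _ ->] := OX i; rewrite opprK.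
rewrite (sin0 _ _ _ O) (sin0 _ _ _ O'); split=> //.
apply: (mulfI (mulf_neq0 J_neq0 e_neq0)); rewrite !mulr_sumr.
pose K := 1 - J ^+ 2 * (a ^+ 2 + b ^+ 2).
apply: (addrI (\sum_(i < n) K)); rewrite -!big_split /=.
have := orbit_cos_sum O O'; congr (_ = _); apply: eq_bigr => i _.
  by have [_ _ -> _ _] := O i; rewrite /K; ring.
by have [_ _ -> _ _] := O' i; rewrite /K; ring.
Qed.

End DirectionOrbits.

(** * Reflection at a point of the ellipse *)

(** Here [(nx, ny)] is the gradient [(X / a^2, Y / b^2)] at a point [(X, Y)] of
   the ellipse, and [(x, y)], [(x', y')] are the directions of the sides that
   arrive at this point and leave it. *)
Section Bounce.
Variables (R : realFieldType) (a b J x y x' y' nx ny : R).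
Hypotheses (ellE : a ^+ 2 * nx ^+ 2 + b ^+ 2 * ny ^+ 2 = 1)
  (unitE : x ^+ 2 + y ^+ 2 = 1)
  (inE : x * nx + y * ny = J) (outE : x' * nx + y' * ny = - J)
  (tanE : x' * ny - y' * nx = x * ny - y * nx).

Local Notation k := (nx ^+ 2 + ny ^+ 2).

Lemma normal_neq0 : k != 0.
Proof.
apply/eqP => /eqP; rewrite paddr_eq0 ?sqr_ge0 // !sqrf_eq0.
move=> /andP[/eqP nx0 /eqP ny0]; move: ellE; rewrite nx0 ny0; lra.
Qed.

(** The two directions have the same component along the tangent and opposite
   components along the normal. *)
Lemma directions_in_normal_frame : exists tau,
  [/\ x = (J * nx - tau * ny) / k, y = (J * ny + tau * nx) / k,
      x' = (- J * nx - tau * ny) / k, y' = (- J * ny + tau * nx) / k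
    & J ^+ 2 + tau ^+ 2 = k].
Proof.
have kn0 := normal_neq0; exists (y * nx - x * ny).
have tauE : y * nx - x * ny = y' * nx - x' * ny.
  by rewrite -opprB -tanE opprB.
split; try apply: (canRL (mulfK kn0)).
- by rewrite -inE; ring.
- by rewrite -inE; ring.
- by rewrite -outE tauE; ring.
- by rewrite -outE tauE; ring.
by rewrite -inE -[RHS]mul1r -unitE; ring.
Qed.

Lemma bounce_diff :
  x' - x = - (2 * J) * (nx / k) /\ y' - y = - (2 * J) * (ny / k).
Proof.
by have [tau [-> -> -> -> _]] := directions_in_normal_frame; split; ring.
Qed.

Lemma bounce_cos_sum : x * x' - y * y' = (ny ^+ 2 - nx ^+ 2) / k.
Proof.
have kn0 := normal_neq0.
have [tau [xE yE x'E y'E hk]] := directions_in_normal_frame.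
rewrite {1}xE {1}yE x'E y'E.
transitivity ((J ^+ 2 + tau ^+ 2) * (ny ^+ 2 - nx ^+ 2) / k ^+ 2).
  by field.
by rewrite hk; field.
Qed.

Lemma bounce_sin_sum : x * y' + y * x' = - (2 * (nx * ny)) / k.
Proof.
have kn0 := normal_neq0.
have [tau [xE yE x'E y'E hk]] := directions_in_normal_frame.
rewrite {1}xE {1}yE x'E y'E.
transitivity (- (J ^+ 2 + tau ^+ 2) * (2 * (nx * ny)) / k ^+ 2); first by field.
by rewrite hk; field.
Qed.

Lemma bounce_cos_diff : x * x' + y * y' = 1 - J ^+ 2 * (a ^+ 2 + b ^+ 2)
  + J ^+ 2 * (a ^+ 2 - b ^+ 2) * (x * x' - y * y').
Proof.
have kn0 := normal_neq0.
have [tau [xE yE x'E y'E hk]] := directions_in_normal_frame.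
rewrite bounce_cos_sum.
transitivity (1 - 2 * J ^+ 2 / k).
  rewrite {1}xE {1}yE x'E y'E; transitivity ((tau ^+ 2 - J ^+ 2) / k).
    by field.
  by rewrite (_ : tau ^+ 2 = k - J ^+ 2); [field | rewrite -hk; ring].
transitivity (1 - 2 * J ^+ 2 / k * (a ^+ 2 * nx ^+ 2 + b ^+ 2 * ny ^+ 2)).
  by rewrite ellE mulr1.
by field.
Qed.

Local Notation p := (x * (b ^+ 2 * ny) - y * (a ^+ 2 * nx)).
Local Notation p' := (x' * (b ^+ 2 * ny) - y' * (a ^+ 2 * nx)).

Lemma bounce_support_sum : J * (p + p') = - (x * y' - y * x').
Proof.
have kn0 := normal_neq0.
have [tau [xE yE x'E y'E hk]] := directions_in_normal_frame.
transitivity (- 2 * J * tau / k * (a ^+ 2 * nx ^+ 2 + b ^+ 2 * ny ^+ 2)).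
  by rewrite xE yE x'E y'E; field.
by rewrite ellE xE yE x'E y'E; field.
Qed.

Lemma bounce_support_diff :
  p' - p = - (J * (a ^+ 2 - b ^+ 2) * (x * y' + y * x')).
Proof.
have kn0 := normal_neq0.
have [tau [xE yE x'E y'E hk]] := directions_in_normal_frame.
by rewrite bounce_sin_sum xE yE x'E y'E; field.
Qed.

(** Lagrange's identity for the quadratic form of the ellipse. *)
Lemma chord_support : p ^+ 2 = b ^+ 2 * x ^+ 2 + a ^+ 2 * y ^+ 2
  - J ^+ 2 * a ^+ 2 * b ^+ 2.
Proof.
by rewrite -[X in _ = X - _]mulr1 -ellE -inE; ring.
Qed.

Lemma foot_coord (px py qx qy : R) :
  qx * nx + qy * ny = 1 -> (px - qx) * ny - (py - qy) * nx = 0 ->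
  qx - px = (1 - (px * nx + py * ny)) * (nx / k) /\
  qy - py = (1 - (px * nx + py * ny)) * (ny / k).
Proof.
move=> h1 h2; have kn0 := normal_neq0.
split; rewrite mulrA; apply: (canRL (mulfK kn0)).
  transitivity ((qx * nx + qy * ny - (px * nx + py * ny)) * nx
    - ny * ((px - qx) * ny - (py - qy) * nx)); first by ring.
  by rewrite h1 h2; ring.
transitivity ((qx * nx + qy * ny - (px * nx + py * ny)) * ny
  + nx * ((px - qx) * ny - (py - qy) * nx)); first by ring.
by rewrite h1 h2; ring.
Qed.

Hypothesis J_neq0 : J != 0.

Lemma foot_bounce (px py qx qy : R) :
  qx * nx + qy * ny = 1 -> (px - qx) * ny - (py - qy) * nx = 0 ->
  let c := x * x' - y * y' in let s := x * y' + y * x' in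
  [/\ qx - px = - (x' - x) / (2 * J) - px * ((1 - c) / 2) + py * (s / 2),
      qy - py = - (y' - y) / (2 * J) + px * (s / 2) - py * ((1 + c) / 2)
    & (qx - px) ^+ 2 + (qy - py) ^+ 2 =
      (a ^+ 2 + px ^+ 2) * ((1 - c) / 2) + (b ^+ 2 + py ^+ 2) * ((1 + c) / 2)
      - px * py * s + (px * (x' - x) + py * (y' - y)) / J].
Proof.
move=> h1 h2 c s; have kn0 := normal_neq0; have [dx dy] := bounce_diff.
have [-> ->] := foot_coord h1 h2; rewrite dx dy /c /s bounce_cos_sum.
rewrite bounce_sin_sum; split; try by field; apply/andP.
transitivity ((1 - (px * nx + py * ny)) ^+ 2 / k); first by field.
transitivity ((a ^+ 2 * nx ^+ 2 + b ^+ 2 * ny ^+ 2 - 2 * (px * nx + py * ny)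
  + (px * nx + py * ny) ^+ 2) / k); first by rewrite ellE; ring.
by field; apply/andP.
Qed.

End Bounce.

(** * Coordinates along the axes of the ellipse *)

Section PlaneVectors.
Variable R : realType.
Implicit Types u v w : plane R.

Lemma dotpE u v : dotp u v = u 0 0 * v 0 0 + u 0 1 * v 0 1.
Proof.
rewrite /dotp mxE big_ord_recl big_ord1 !mxE.
by congr (_ + _ * _); congr (_ _ _); apply: val_inj.
Qed.

Lemma dotpDl u v w : dotp (u + v) w = dotp u w + dotp v w.
Proof. by rewrite /dotp mulmxDl mxE. Qed.

Lemma dotpZl r u w : dotp (r *: u) w = r * dotp u w.
Proof. by rewrite /dotp -scalemxAl mxE. Qed.

Lemma dotpNl u w : dotp (- u) w = - dotp u w.
Proof. by rewrite -scaleN1r dotpZl mulN1r. Qed.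

Lemma dotpBl u v w : dotp (u - v) w = dotp u w - dotp v w.
Proof. by rewrite dotpDl dotpNl. Qed.

Lemma dotpNr u w : dotp u (- w) = - dotp u w.
Proof. by rewrite /dotp linearN mulmxN mxE. Qed.

Lemma dotp_suml (I : finType) (F : I -> plane R) w :
  dotp (\sum_i F i) w = \sum_i dotp (F i) w.
Proof. by rewrite /dotp mulmx_suml summxE. Qed.

Lemma dotp_ge0 u : 0 <= dotp u u.
Proof. by rewrite dotpE addr_ge0 // -expr2 sqr_ge0. Qed.

Lemma dotp_eq0 u : (dotp u u == 0) = (u == 0).
Proof.
apply/eqP/eqP => [|->]; last by rewrite dotpE !mxE !mul0r addr0.
rewrite dotpE -!expr2 => /eqP; rewrite paddr_eq0 ?sqr_ge0 // !sqrf_eq0.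
move=> /andP[/eqP u0 /eqP u1]; apply/rowP => j; rewrite mxE.
by case: j => [[|[|//]] ?]; [rewrite -u0 | rewrite -u1]; congr (u _ _);
  apply: val_inj.
Qed.

Lemma sqr_enorm u : enorm u ^+ 2 = dotp u u.
Proof. by rewrite /enorm sqr_sqrtr // dotp_ge0. Qed.

Lemma enorm_gt0 u : (0 < enorm u) = (u != 0).
Proof. by rewrite /enorm sqrtr_gt0 lt_def dotp_ge0 andbT dotp_eq0. Qed.

Lemma enormN u : enorm (- u) = enorm u.
Proof. by rewrite /enorm dotpNl dotpNr opprK. Qed.

Lemma cauchy_schwarz u v : dotp u v ^+ 2 <= (enorm u * enorm v) ^+ 2.
Proof.
rewrite exprMn !sqr_enorm !dotpE -subr_ge0.
apply: le_trans (sqr_ge0 (u 0 0 * v 0 1 - u 0 1 * v 0 0)) _.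
by rewrite le_eqVlt; apply/orP; left; apply/eqP; ring.
Qed.

Lemma cos_angle u v : cos (angle u v) = dotp u v / (enorm u * enorm v).
Proof.
rewrite /angle acosK // in_itv /= -ler_norml.
have E0 : 0 <= enorm u * enorm v by rewrite mulr_ge0 // sqrtr_ge0.
have [e0|en0] := eqVneq (enorm u * enorm v) 0.
  by rewrite e0 invr0 mulr0 normr0.
have E_gt0 : 0 < enorm u * enorm v by rewrite lt_def en0.
rewrite normrM normfV (ger0_norm E0) ler_pdivrMr // mul1r.
by rewrite -(@ler_pXn2r _ 2) ?nnegrE // real_normK ?num_real // cauchy_schwarz.
Qed.

End PlaneVectors.

Section EllipseCoordinates.
Variables (R : realType) (g : ellipse R).
Implicit Types u v X : plane R.
Local Notation a := (semi_a g).
Local Notation b := (semi_b g).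

Definition along u : R := dotp u (axis g).
Definition across u : R := dotp u (rot90 (axis g)).
Definition from_axes (s t : R) : plane R :=
  s *: axis g + t *: rot90 (axis g).

Lemma axis_sqr : axis g 0 0 ^+ 2 + axis g 0 1 ^+ 2 = 1.
Proof. by rewrite -(axis_unit g) dotpE. Qed.

Lemma dotp_axes u v : dotp u v = along u * along v + across u * across v.
Proof.
rewrite /along /across !dotpE !mxE /= -[LHS]mulr1 -axis_sqr.
by ring.
Qed.

Lemma along_from_axes s t : along (from_axes s t) = s.
Proof.
rewrite /along !dotpE !mxE /= -[RHS]mulr1 -axis_sqr; ring.
Qed.

Lemma across_from_axes s t : across (from_axes s t) = t.
Proof.
rewrite /across !dotpE !mxE /= -[RHS]mulr1 -axis_sqr; ring.
Qed.

Lemma axes_inj u v : along u = along v -> across u = across v -> u = v.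
Proof.
move=> e1 e2; apply/eqP; rewrite -subr_eq0 -dotp_eq0 dotp_axes.
rewrite /along /across !dotpBl -/(along u) -/(across u) e1 e2.
by rewrite !subrr !mulr0 addr0.
Qed.

Lemma xcoordB X Y : xcoord g X - xcoord g Y = along (X - Y).
Proof. by rewrite /xcoord /along !dotpBl; ring. Qed.

Lemma ycoordB X Y : ycoord g X - ycoord g Y = across (X - Y).
Proof. by rewrite /ycoord /across !dotpBl; ring. Qed.

Lemma sqr_enorm_coord X Y : enorm (X - Y) ^+ 2 =
  (xcoord g X - xcoord g Y) ^+ 2 + (ycoord g X - ycoord g Y) ^+ 2.
Proof. by rewrite sqr_enorm dotp_axes xcoordB ycoordB -!expr2. Qed.

Lemma conic_form0 X Y : conic_form g 0 X Y =
  xcoord g Y * (xcoord g X / a ^+ 2) + ycoord g Y * (ycoord g X / b ^+ 2).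
Proof. by rewrite /conic_form !subr0; ring. Qed.

End EllipseCoordinates.

(** * From billiard polygons to direction orbits *)

Section BilliardPolygons.
Variables (R : realType) (g : ellipse R).
Implicit Types A B M P Q X : plane R.
Local Notation a := (semi_a g).
Local Notation b := (semi_b g).
Local Notation nx M := (xcoord g M / a ^+ 2).
Local Notation ny M := (ycoord g M / b ^+ 2).

Let b_gt0 : 0 < b := semi_b_gt0 g.
Let a_gt0 : 0 < a := lt_le_trans b_gt0 (semi_b_le_a g).
Let a_neq0 : a != 0. Proof. by rewrite gt_eqF. Qed.
Let b_neq0 : b != 0. Proof. by rewrite gt_eqF. Qed.

(** The tangent lines of a conic with denominators [al], [be] are those whose
   support number satisfies [p^2 = be x^2 + al y^2]; the asymptotes are the
   solutions with [p = 0]. Here the direction is not normalised. *)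
Lemma tangent_support lam A B : confocal_param g lam ->
  tangent_to g lam (line A B) ->
  (along g (B - A) * ycoord g A - across g (B - A) * xcoord g A) ^+ 2 =
  (b ^+ 2 - lam) * along g (B - A) ^+ 2
  + (a ^+ 2 - lam) * across g (B - A) ^+ 2.
Proof.
move=> [lam_lt /eqP lam_neq].
have al_neq0 : a ^+ 2 - lam != 0 by rewrite subr_eq0 gt_eqF.
have be_neq0 : b ^+ 2 - lam != 0 by rewrite subr_eq0 eq_sym.
have lineA : line A B A by exists 0; rewrite scale0r addr0.
have lineB : line A B B by exists 1; rewrite scale1r addrC subrK.
rewrite -xcoordB -ycoordB.
case=> [[T TT LE]|[T [_ TT LE]]].
  move: lineA lineB; rewrite LE /tangent_at /confocal_conic /= in TT *.
  rewrite /conic_form in TT *; move: TT.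
  set xT := xcoord g T; set yT := ycoord g T.
  set xA := xcoord g A; set yA := ycoord g A.
  set xB := xcoord g B; set yB := ycoord g B => TT hA hB.
  pose tx := xT / (a ^+ 2 - lam); pose ty := yT / (b ^+ 2 - lam).
  have eA : tx * xA + ty * yA = 1 by rewrite -hA /tx /ty; ring.
  have eB : tx * (xB - xA) + ty * (yB - yA) = 0.
    by rewrite -[RHS](subrr 1) -{1}hB -hA /tx /ty; ring.
  have eT : (a ^+ 2 - lam) * tx ^+ 2 + (b ^+ 2 - lam) * ty ^+ 2 = 1.
    by rewrite -TT /tx /ty; field; apply/andP.
  set m := (xB - xA) * yA - (yB - yA) * xA.
  have mx : m * ty = xB - xA.
    transitivity ((xB - xA) * (tx * xA + ty * yA)
      - xA * (tx * (xB - xA) + ty * (yB - yA))); first by rewrite /m; ring.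
    by rewrite eA eB; ring.
  have my : m * tx = - (yB - yA).
    transitivity (- ((yB - yA) * (tx * xA + ty * yA))
      + yA * (tx * (xB - xA) + ty * (yB - yA))); first by rewrite /m; ring.
    by rewrite eA eB; ring.
  by rewrite -[LHS]mulr1 -eT -mx -[yB - yA]opprK -my; ring.
have coordC s :
    xcoord g (Defs.center g + s *: (T - Defs.center g)) = s * xcoord g T /\
    ycoord g (Defs.center g + s *: (T - Defs.center g)) = s * ycoord g T.
  by rewrite /xcoord /ycoord addrC addrA addNr add0r !dotpZl.
move: lineA lineB; rewrite LE => -[s ->] [t ->].
have [-> ->] := coordC s; have [-> ->] := coordC t.
transitivity ((t - s) ^+ 2 * ((a ^+ 2 - lam) * (b ^+ 2 - lam))
  * conic_form g lam T T); first by rewrite TT; ring.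
by rewrite /conic_form; field; apply/andP.
Qed.

Lemma curveE M : curve g M ->
  a ^+ 2 * (nx M) ^+ 2 + b ^+ 2 * (ny M) ^+ 2 = 1.
Proof.
rewrite /curve /confocal_conic /= conic_form0 => <-.
by field; apply/andP.
Qed.

(** Evaluate the reflection law at one tangent vector: equality of the cosines
   says that the unit vectors towards [A] and [B] have opposite components
   along the tangent. *)
Lemma reflection_tangential A M B : curve g M ->
  reflection_law g A M B ->
  (across g (A - M) * nx M - along g (A - M) * ny M) / enorm (A - M) =
  - (across g (B - M) * nx M - along g (B - M) * ny M) / enorm (B - M).
Proof.
move=> hM refl.
pose T := from_axes g (- ny M) (nx M).
have TE U : dotp U T = across g U * nx M - along g U * ny M.
  by rewrite (dotp_axes g) along_from_axes across_from_axes; ring.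
have T_neq0 : T != 0.
  rewrite -dotp_eq0 TE along_from_axes across_from_axes.
  have := normal_neq0 (curveE hM); apply: contra => /eqP <-; apply/eqP; ring.
have ET_neq0 : enorm T != 0 by rewrite gt_eqF // enorm_gt0.
have TL : tangent_line g M (M + T).
  rewrite /tangent_line /tangent_at /= conic_form0.
  have -> : xcoord g (M + T) = xcoord g M - ny M.
    rewrite -[LHS](subrK (xcoord g M)) xcoordB addrC (addrC M) addrK.
    by rewrite along_from_axes.
  have -> : ycoord g (M + T) = ycoord g M + nx M.
    rewrite -[LHS](subrK (ycoord g M)) ycoordB addrC (addrC M) addrK.
    by rewrite across_from_axes.
  rewrite -(curveE hM); field; exact/andP.
have MT_neq : M + T <> M
  by move/eqP; rewrite -subr_eq0 addrAC subrr add0r (negPf T_neq0).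
have /(congr1 cos) := refl _ TL MT_neq.
have -> : M + T - M = T by rewrite addrAC subrr add0r.
have -> : M - (M + T) = - T by rewrite opprD addrA subrr add0r.
rewrite !cos_angle enormN dotpNr !TE.
move=> /(congr1 ( *%R^~ (enorm T))).
by rewrite !invfM !mulrA !divfK.
Qed.

(** The equations of the ellipse at the two ends of a chord differ by a multiple
   of the sum of the scalar products of its direction with the gradients there,
   which are therefore opposite. *)
Lemma chord_normal (X Y x y e : R) : e != 0 ->
  a ^+ 2 * (X / a ^+ 2) ^+ 2 + b ^+ 2 * (Y / b ^+ 2) ^+ 2 = 1 ->
  a ^+ 2 * ((X + e * x) / a ^+ 2) ^+ 2 + b ^+ 2 * ((Y + e * y) / b ^+ 2) ^+ 2
    = 1 ->
  let c := e / 2 * (x ^+ 2 / a ^+ 2 + y ^+ 2 / b ^+ 2) in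
  x * (X / a ^+ 2) + y * (Y / b ^+ 2) = - c /\
  x * ((X + e * x) / a ^+ 2) + y * ((Y + e * y) / b ^+ 2) = c.
Proof.
move=> e0 h1 h2 c.
have h : x * (X / a ^+ 2) + y * (Y / b ^+ 2) = - c.
  apply: (mulfI (_ : 2 * e != 0)); first by rewrite mulf_neq0 ?pnatr_eq0.
  apply/eqP; rewrite -subr_eq0; apply/eqP; transitivity (1 - 1 : R).
    by rewrite -[X in _ = X - _]h2 -[X in _ = _ - X]h1 /c; field; apply/andP.
  exact: subrr.
split=> //.
transitivity (x * (X / a ^+ 2) + y * (Y / b ^+ 2) + 2 * c); last first.
  by rewrite h; ring.
by rewrite /c; field; apply/andP.
Qed.

Lemma weighted_norm_gt0 (u v : R) :
  u ^+ 2 + v ^+ 2 = 1 -> 0 < u ^+ 2 / a ^+ 2 + v ^+ 2 / b ^+ 2.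
Proof.
move=> uv1; rewrite lt_def addr_ge0 ?divr_ge0 ?sqr_ge0 // andbT.
rewrite paddr_eq0 ?divr_ge0 ?sqr_ge0 // !mulf_eq0 !invr_eq0 !expf_eq0 /=.
rewrite (negPf a_neq0) (negPf b_neq0) !orbF !orbb.
apply/negP => /andP[/eqP u0 /eqP v0].
by move: uv1; rewrite u0 v0; lra.
Qed.

Section Polygon.
Variables (n : nat) (lam : R) (M : 'I_n -> plane R).
Hypotheses (lam_ok : confocal_param g lam) (hM : billiard_family g lam M).

Let e i := enorm (M (ordS i) - M i).
Let x i := along g (M (ordS i) - M i) / e i.
Let y i := across g (M (ordS i) - M i) / e i.
Let p i := x i * ycoord g (M i) - y i * xcoord g (M i).
Let J i := e i / 2 * (x i ^+ 2 / a ^+ 2 + y i ^+ 2 / b ^+ 2).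

Let e_gt0 i : 0 < e i.
Proof.
have [/(_ i)[_ /eqP neq _] _] := hM.
by rewrite enorm_gt0 subr_eq0 eq_sym.
Qed.

Let ellipseE i := curveE (let: And3 h _ _ := (proj1 hM) i in h).

Let unitE i : x i ^+ 2 + y i ^+ 2 = 1.
Proof.
have e0 := e_gt0 i.
rewrite /x /y !expr_div_n -mulrDl !(expr2 (along _ _)) !(expr2 (across _ _)).
by rewrite -dotp_axes -sqr_enorm divff // expf_neq0 // gt_eqF.
Qed.

Let xS i : xcoord g (M (ordS i)) = xcoord g (M i) + e i * x i.
Proof. by rewrite /x mulrC divfK ?gt_eqF // -xcoordB addrC subrK. Qed.

Let yS i : ycoord g (M (ordS i)) = ycoord g (M i) + e i * y i.
Proof. by rewrite /y mulrC divfK ?gt_eqF // -ycoordB addrC subrK. Qed.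

Let normalE i : x i * nx (M i) + y i * ny (M i) = - J i /\
  x i * nx (M (ordS i)) + y i * ny (M (ordS i)) = J i.
Proof.
have := ellipseE (ordS i); rewrite xS yS; apply: chord_normal (ellipseE i).
by rewrite gt_eqF.
Qed.

Let J_gt0 i : 0 < J i.
Proof.
by rewrite mulr_gt0 ?divr_gt0 // weighted_norm_gt0.
Qed.

(** The incoming direction points away from the previous vertex, so the opposite
   components of the reflection law become equal ones. *)
Let tangentialE i (j := ordS i) :
  x j * ny (M j) - y j * nx (M j) = x i * ny (M j) - y i * nx (M j).
Proof.
have [/(_ j)[hj _ refl] _] := hM.
move: refl; rewrite {1}/j ordSK => refl.
have := reflection_tangential hj refl.
rewrite -[M i - M j]opprB enormN /along /across !dotpNl -/(e i) -/(e j).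
rewrite -/(along g _) -/(across g _) -/(along g (M (ordS j) - M j)).
rewrite -/(across g (M (ordS j) - M j)) => h.
transitivity (- ((across g (M (ordS j) - M j) * nx (M j) -
   along g (M (ordS j) - M j) * ny (M j)) / e j)); first by rewrite /x /y; ring.
by rewrite -mulNr -h /x /y -/j; ring.
Qed.

Let supportE i : p i ^+ 2 =
  b ^+ 2 * x i ^+ 2 + a ^+ 2 * y i ^+ 2 - J i ^+ 2 * a ^+ 2 * b ^+ 2.
Proof.
have [h _] := normalE i; have := chord_support (ellipseE i) h.
rewrite sqrrN => <-; congr (_ ^+ 2); rewrite /p; field; exact/andP.
Qed.

(** Joachimsthal's invariant is read off the caustic: compare the support number
   of a side as a chord of the ellipse and as a tangent of the caustic. *)
Let J_lam i : J i ^+ 2 * a ^+ 2 * b ^+ 2 = lam.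
Proof.
have := tangent_support lam_ok (proj2 hM i).
have -> : along g (M (ordS i) - M i) = e i * x i.
  by rewrite /x mulrC divfK ?gt_eqF.
have -> : across g (M (ordS i) - M i) = e i * y i.
  by rewrite /y mulrC divfK ?gt_eqF.
move=> h; have e2_neq0 : e i ^+ 2 != 0 by rewrite expf_neq0 // gt_eqF.
have : p i ^+ 2 = (b ^+ 2 - lam) * x i ^+ 2 + (a ^+ 2 - lam) * y i ^+ 2.
  apply: (mulfI e2_neq0).
  transitivity ((e i * x i * ycoord g (M i) - e i * y i * xcoord g (M i)) ^+ 2).
    by rewrite /p; ring.
  by rewrite h; ring.
rewrite supportE => h'; have u := unitE i.
transitivity (lam * (x i ^+ 2 + y i ^+ 2)); last by rewrite u mulr1.
by lra.
Qed.

Let J_sqrt i : J i = Num.sqrt lam / (a * b).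
Proof.
have ab_gt0 : 0 < a * b by rewrite mulr_gt0.
rewrite -(J_lam i) -!exprMn -mulrA sqrtr_sqr gtr0_norm; last exact: mulr_gt0.
by rewrite mulfK // gt_eqF.
Qed.

Lemma billiard_caustic_gt0 (i : 'I_n) : 0 < lam.
Proof.
rewrite -(J_lam i) -!exprMn; apply/exprn_gt0/mulr_gt0 => //.
exact: mulr_gt0 (J_gt0 i) a_gt0.
Qed.

(** The sides of a billiard polygon form a direction orbit, and the feet are
   expressed through consecutive directions alone. *)
Lemma billiard_direction_orbit : let J0 := Num.sqrt lam / (a * b) in
  exists u v q : 'I_n -> R, direction_orbit a b J0 u v q /\
  forall P (Q : 'I_n -> plane R),
  (forall i, is_foot P (tangent_line g (M i)) (Q i)) ->
  forall i (j := ordS i),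
  let px := xcoord g P in let py := ycoord g P in
  let c := u i * u j - v i * v j in let s := u i * v j + v i * u j in
  [/\ along g (Q j - P) =
        - (u j - u i) / (2 * J0) - px * ((1 - c) / 2) + py * (s / 2),
      across g (Q j - P) =
        - (v j - v i) / (2 * J0) + px * (s / 2) - py * ((1 + c) / 2)
    & enorm (Q j - P) ^+ 2 =
      (a ^+ 2 + px ^+ 2) * ((1 - c) / 2) + (b ^+ 2 + py ^+ 2) * ((1 + c) / 2)
      - px * py * s + (px * (u j - u i) + py * (v j - v i)) / J0].
Proof.
move=> J0; exists x, y, p.
have inE i : x i * nx (M (ordS i)) + y i * ny (M (ordS i)) = J0.
  by have [_ ->] := normalE i; rewrite J_sqrt.
have outE i : x i * nx (M i) + y i * ny (M i) = - J0.
  by have [-> _] := normalE i; rewrite J_sqrt.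
have pE i : p i = x i * (b ^+ 2 * ny (M i)) - y i * (a ^+ 2 * nx (M i)).
  by rewrite /p; field; apply/andP.
have pE' i : p i =
    x i * (b ^+ 2 * ny (M (ordS i))) - y i * (a ^+ 2 * nx (M (ordS i))).
  by rewrite /p xS yS; field; apply/andP.
split=> [i j|P Q hQ i j px py].
  have := bounce_support_diff (ellipseE j) (unitE i) (inE i) (outE j)
    (tangentialE i).
  have := bounce_support_sum (ellipseE j) (unitE i) (inE i) (outE j)
    (tangentialE i).
  rewrite -pE -pE' => psum pdiff; split => //.
  - by rewrite supportE J_sqrt.
  - exact: bounce_cos_diff (ellipseE j) (unitE i) (inE i) (outE j)
      (tangentialE i).
have [QL foot] := hQ j.
have J0_neq0 : J0 != 0 by rewrite /J0 -(J_sqrt i) gt_eqF.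
have h1 : xcoord g (Q j) * nx (M j) + ycoord g (Q j) * ny (M j) = 1.
  by move: QL; rewrite /tangent_line /tangent_at /= conic_form0.
have h2 : (px - xcoord g (Q j)) * ny (M j)
    - (py - ycoord g (Q j)) * nx (M j) = 0.
  pose T := from_axes g (- ny (M j)) (nx (M j)).
  have TL : tangent_line g (M j) (Q j + T).
    rewrite /tangent_line /tangent_at /= conic_form0 -[RHS]h1.
    rewrite -[xcoord g (_ + _)](subrK (xcoord g (Q j))) xcoordB.
    rewrite -[ycoord g (_ + _)](subrK (ycoord g (Q j))) ycoordB.
    rewrite (addrC (Q j)) addrK along_from_axes across_from_axes; ring.
  have := foot _ TL; rewrite (addrC (Q j)) addrK (dotp_axes g).
  rewrite along_from_axes across_from_axes -xcoordB -ycoordB => h.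
  by rewrite -[RHS]oppr0 -h /px /py; ring.
have := foot_bounce (ellipseE j) (unitE i) (inE i) (outE j) (tangentialE i)
  J0_neq0 h1 h2.
by rewrite (sqr_enorm_coord g) -!xcoordB -!ycoordB.
Qed.

End Polygon.

End BilliardPolygons.

(** * Sums over the feet *)

(** Every quantity to be summed has this form: a part that telescopes, the
   double angle terms, and a constant. *)
Lemma orbit_sum_affine (R : realFieldType) (n : nat) (a b J : R)
    (x y p x' y' p' F F' : 'I_n -> R) (al be ga de ep : R) :
  0 < b -> b <= a -> 0 < J -> J * b < 1 ->
  direction_orbit a b J x y p -> direction_orbit a b J x' y' p' ->
  let form x y i := al * (x (ordS i) - x i) + be * (y (ordS i) - y i)
    + ga * (x i * x (ordS i) - y i * y (ordS i))
    + de * (x i * y (ordS i) + y i * x (ordS i)) + ep in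
  (forall i, F (ordS i) = form x y i) ->
  (forall i, F' (ordS i) = form x' y' i) ->
  \sum_(i < n) F i = \sum_(i < n) F' i.
Proof.
move=> b_gt0 b_le_a J_gt0 Jb_lt1 O O' form FE F'E.
have [cE sE] := orbit_double_angle_sum b_gt0 b_le_a J_gt0 Jb_lt1 O O'.
have formE (X Y : 'I_n -> R) : \sum_(i < n) form X Y i =
    ga * \sum_(i < n) (X i * X (ordS i) - Y i * Y (ordS i))
    + de * \sum_(i < n) (X i * Y (ordS i) + Y i * X (ordS i))
    + \sum_(i < n) ep.
  by rewrite 4!big_split /= -!mulr_sumr !sum_telescope !mulr0 !add0r.
rewrite -[LHS]sum_ordS -[RHS]sum_ordS (eq_bigr _ (fun i _ => FE i)).
by rewrite (eq_bigr _ (fun i _ => F'E i)) !formE cE sE.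
Qed.

Theorem theorem4p1 (R : realType) (n : nat) (hn : (3 <= n)%N)
    (g : ellipse R) (lam : R) (hlam : confocal_param g lam)
    (P : plane R) (M M' Q Q' : 'I_n -> plane R)
    (hM : billiard_family g lam M) (hM' : billiard_family g lam M')
    (hQ : forall i, is_foot P (tangent_line g (M i)) (Q i))
    (hQ' : forall i, is_foot P (tangent_line g (M' i)) (Q' i)) :
  n%:R^-1 *: \sum_(i < n) Q i = n%:R^-1 *: \sum_(i < n) Q' i /\
  \sum_(i < n) enorm (Q i - P) ^+ 2 = \sum_(i < n) enorm (Q' i - P) ^+ 2.
Proof.
have b_gt0 := semi_b_gt0 g; have b_le_a := semi_b_le_a g.
have a_gt0 := lt_le_trans b_gt0 b_le_a.
have lam_gt0 : 0 < lam.
  have n_gt0 : (0 < n)%N by exact: leq_trans hn.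
  exact: (billiard_caustic_gt0 hlam hM (Ordinal n_gt0)).
set J := Num.sqrt lam / (semi_a g * semi_b g).
have J_gt0 : 0 < J by rewrite divr_gt0 ?sqrtr_gt0 ?mulr_gt0.
have Jb_lt1 : J * semi_b g < 1.
  rewrite /J invfM mulrA divfK ?gt_eqF // ltr_pdivrMr // mul1r.
  rewrite -[X in _ < X]ger0_norm ?ltW // -sqrtr_sqr ltr_sqrt ?exprn_gt0 //.
  by case: hlam.
have [x [y [p [ofl feet]]]] := billiard_direction_orbit hlam hM.
have [x' [y' [p' [ofl' feet']]]] := billiard_direction_orbit hlam hM'.
have {feet} feet := feet P Q hQ; have {feet'} feet' := feet' P Q' hQ'.
have sumE al be ga de ep F F' :=
  @orbit_sum_affine _ _ _ _ _ _ _ _ _ _ _ F F' al be ga de ep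
    b_gt0 b_le_a J_gt0 Jb_lt1 ofl ofl'.
set px := xcoord g P in feet feet'; set py := ycoord g P in feet feet'.
have J_neq0 : J != 0 by rewrite gt_eqF.
split.
  congr (_ *: _); apply: (addIr (- \sum_(i < n) P)); rewrite -!sumrB.
  apply: (@axes_inj _ g); rewrite /along /across !dotp_suml.
    apply: (sumE (- (2 * J)^-1) 0 (px / 2) (py / 2) (- (px / 2))) => i.
      by have [e _ _] := feet i; rewrite [LHS]e -/J; field.
    by have [e _ _] := feet' i; rewrite [LHS]e -/J; field.
  apply: (sumE 0 (- (2 * J)^-1) (- (py / 2)) (px / 2) (- (py / 2))) => i.
    by have [_ e _] := feet i; rewrite [LHS]e -/J; field.
  by have [_ e _] := feet' i; rewrite [LHS]e -/J; field.
apply: (sumE (px / J) (py / J)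
  ((semi_b g ^+ 2 + py ^+ 2 - semi_a g ^+ 2 - px ^+ 2) / 2) (- (px * py))
  ((semi_a g ^+ 2 + px ^+ 2 + semi_b g ^+ 2 + py ^+ 2) / 2)) => i.
  by have [_ _ ->] := feet i; rewrite -/J; field.
by have [_ _ ->] := feet' i; rewrite -/J; field.
Qed.
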